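(* Let $G$ be a finite abelian group of order $n$, let $S\subset G^n$ be the set of bijections $\{1,\dots,n\}\to G$, and let $f:\{1,\dots,n\}\to G$ be any function. Let $m\ge 0$ be an integer. If $m$ is even then \[ \sum_{m\text{-sparse}~\chi} \widehat{1_S}(\chi)^3 \chi(f) = \frac{1}{(m/2)!}\Big(-\frac{1}{2n^2}\sum_{x\in G}|f^{-1}(x)|^2\Big)^{m/2}\Big(\frac{n!}{n^n}\Big)^3 + O_m\Big(\frac1n\Big(\frac{n!}{n^n}\Big)^3\Big), \] while if $m$ is odd then \[ \sum_{m\text{-sparse}~\chi} |\widehat{1_S}(\chi)|^3 = O_m\Big(\frac1n\Big(\frac{n!}{n^n}\Big)^3\Big). \] Here the implied constants depend only on $m$.
   Context: $\hat G$ denotes the dual group of $G$ (characters $G\to\mathbb{C}^\times$), written additively, with $0$ the trivial character. For $\chi=(\chi_1,\dots,\chi_n)\in\hat G^n$, the Fourier transform is $\widehat{1_S}(\chi)=\frac{1}{n^n}\sum_{\pi\in S}\prod_{i=1}^n\chi_i(\pi(i))$ (equivalently $\frac1{n^n}$ times the sum of $\chi_1(x_1)\cdots\chi_n(x_n)$ over distinct $x_1,\dots,x_n\in G$), and $\chi(f)=\prod_{i=1}^n\chi_i(f(i))$. A character $\chi\in\hat G^n$ is $m$-sparse if exactly $m$ of its coordinates $\chi_i$ are nontrivial. $f^{-1}(x)=\{i:f(i)=x\}$. *)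

(* Defs.v *)
From HB Require Import structures.
From mathcomp Require Import all_boot all_order all_algebra all_fingroup all_solvable all_field all_character.
Set Implicit Arguments. Unset Strict Implicit. Unset Printing Implicit Defensive.
Import Order.TTheory GRing.Theory Num.Theory.
Local Open Scope ring_scope.

(* The finite abelian group G is the whole of a finGroupType gT (with
   [set: gT] abelian); n = #|gT|.  The dual group \hat G is indexed by
   Iirr [set: gT] (irreducible = linear characters, since G is abelian);
   the index 0 is the trivial character ('chi_0 = 1).  Values in algC. *)

Definition bijS (gT : finGroupType) : {set {ffun 'I_#|gT| -> gT}} :=
  [set p : {ffun 'I_#|gT| -> gT} | injectiveb p].

Definition chiev (gT : finGroupType) (chi : {ffun 'I_#|gT| -> Iirr [set: gT]})
    (g : 'I_#|gT| -> gT) : algC :=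
  \prod_(i < #|gT|) 'chi_(chi i) (g i).

Definition hat1S (gT : finGroupType) (chi : {ffun 'I_#|gT| -> Iirr [set: gT]}) : algC :=
  (#|gT| ^ #|gT|)%:R^-1 * \sum_(p in bijS gT) chiev chi p.

Definition sparse (gT : finGroupType) (m : nat) (chi : {ffun 'I_#|gT| -> Iirr [set: gT]}) : bool :=
  #|[set i | chi i != 0]| == m.

Definition fibre_card (gT : finGroupType) (f : 'I_#|gT| -> gT) (x : gT) : nat :=
  #|[set i | f i == x]|.

(* Main.v *)
Require Import Defs.
From HB Require Import structures.
From mathcomp Require Import all_boot all_order all_algebra all_fingroup all_solvable all_field all_character.
From mathcomp Require Import ring.
Set Implicit Arguments. Unset Strict Implicit. Unset Printing Implicit Defensive.
Import Order.TTheory GRing.Theory Num.Theory.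
Local Open Scope ring_scope.

(** Let a(chi) be the mean of chi(p) over the bijections p.  If chi_j is
    nontrivial then sum_i chi_j(p(i)) = 0 for every bijection p; averaging this
    against the other coordinates, the m-sparse chi satisfies
      (n - m + 1) a(chi) = - sum_i a(chi with chi_j moved onto coordinate i),
    where i runs over the other nontrivial coordinates (for trivial chi_i the
    moved character has the same mean, by symmetry).  Each move lowers the
    sparsity by 1, or by 2 when chi_i = -chi_j.  Induction on m gives
    |a(chi)| = O(n^-ceil(m/2)) and, for a fixed support of size m,
    sum |a(chi)|^2 = O(n^-ceil(m/2)); the odd case follows, as there are at most
    n^m supports.
    For even m, cube the recursion: up to a relative error O(1/n) only the
    diagonal terms with chi_i = -chi_j survive, and summing over chi_j makes them
    n [f(i) = f(j)] - 1 times the cubic sum over the support without i, j.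
    Double counting the triples (support, j, i) gives, for the total V_m,
      m V_m = - n^-2 (sum_x |f^-1(x)|^2) V_(m-2) + O(1/n).                     *)

(** * The dual group and orthogonality of characters *)

Section DualGroup.
Variable gT : finGroupType.
Hypothesis abG : abelian [set: gT].
Local Notation dual := (Iirr [set: gT]).

Definition dual_mul (a b : dual) : dual := cfIirr ('chi_a * 'chi_b).

Lemma dual_linear (a : dual) : 'chi_a \is a linear_char.
Proof. exact: (char_abelianP _ abG). Qed.

Lemma dual_mulE (a b : dual) : 'chi_(dual_mul a b) = 'chi_a * 'chi_b.
Proof. by rewrite cfIirrE // mul_lin_irr ?dual_linear ?mem_irr. Qed.

Lemma normC_dual (a : dual) x : `|'chi_a x| = 1.
Proof. by rewrite normC_lin_char ?dual_linear ?inE. Qed.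

Lemma dual_mul0 (a : dual) : dual_mul 0 a = a.
Proof. by apply: irr_inj; rewrite dual_mulE irr0 mul1r. Qed.

Lemma dual_conjM (a : dual) : 'chi_(conjC_Iirr a) * 'chi_a = 1.
Proof.
apply/cfunP=> x; rewrite cfunE conjC_IirrE cfunE cfun1E inE.
by rewrite mulrC -normCK normC_dual expr1n.
Qed.

Lemma dual_mulVK (a b : dual) : dual_mul (conjC_Iirr a) (dual_mul a b) = b.
Proof. by apply: irr_inj; rewrite !dual_mulE mulrA dual_conjM mul1r. Qed.

Lemma dual_mulC (a b : dual) : dual_mul a b = dual_mul b a.
Proof. by apply: irr_inj; rewrite !dual_mulE mulrC. Qed.

Lemma dual_mulKV (a b : dual) : dual_mul (dual_mul a b) (conjC_Iirr b) = a.
Proof. by rewrite dual_mulC [dual_mul a b]dual_mulC dual_mulVK. Qed.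

Lemma dual_mulV (a : dual) : dual_mul (conjC_Iirr a) a = 0.
Proof. by apply: irr_inj; rewrite dual_mulE irr0 dual_conjM. Qed.

Lemma dual_mul_eq0 (a b : dual) : (dual_mul a b == 0) = (a == conjC_Iirr b).
Proof.
apply/eqP/eqP=> [ab0 | ->]; last exact: dual_mulV.
by rewrite -(dual_mulKV a b) ab0 dual_mul0.
Qed.

Lemma dual_sum0 (a : dual) : a != 0 -> \sum_x 'chi_a x = 0.
Proof.
move=> a0; have := cfdot_irr a 0; rewrite (negPf a0) irr0 cfdotE => /eqP.
rewrite mulf_eq0 invr_eq0 pnatr_eq0 cardsT.
have /lt0n_neq0/negPf-> : (0 < #|gT|)%N by apply/card_gt0P; exists 1%g.
move=> /eqP a_sum; rewrite -[RHS]a_sum.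
apply: eq_big => [x|x _]; rewrite ?inE //.
by rewrite cfun1E inE rmorph1 mulr1.
Qed.

Lemma dual_orthogonality x y :
  \sum_(a : dual) 'chi_a x * ('chi_a y)^* = (#|gT| * (x == y))%:R.
Proof.
rewrite second_orthogonality_relation ?inE //.
(* Commutativity makes classes singletons and centralisers everything, so the second orthogonality
   relation becomes n times a delta. *)
have cA z : (z ^: [set: gT])%g = [set z].
  apply/eqP; rewrite eqEsubset sub1set class_refl andbT.
  apply/subsetP=> w /imsetP[u _ ->]; rewrite inE conjgE.
  by rewrite (centsP abG z _ u) ?inE // mulKg.
have -> : ('C_[set: gT][x])%g = [set: gT].
  apply/setP=> z; rewrite in_setI in_setT; apply/cent1P.
  by apply: (centsP abG); rewrite inE.
by rewrite cA cardsT inE; case: (x == y); rewrite ?muln0 ?muln1.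
Qed.

End DualGroup.

(** * Moving one coordinate character onto another: the recursion for the means *)

Section Merging.
Variable gT : finGroupType.
Hypothesis abG : abelian [set: gT].
Local Notation dual := (Iirr [set: gT]).
Local Notation n := #|gT|.
Local Notation dualn := {ffun 'I_n -> dual}.

Definition supp (chi : dualn) : {set 'I_n} := [set i | chi i != 0].

(* hat1S divided by its value n! / n^n at the trivial character. *)
Definition bij_mean (chi : dualn) : algC :=
  (n`!)%:R^-1 * \sum_(p in bijS gT) chiev chi p.

(** For [i = j] the first test wins and the coordinate is only erased; the lemmas below always work
    with [i != j]. *)
Definition merge (i j : 'I_n) (chi : dualn) : dualn :=
  [ffun k => if k == j then 0
             else if k == i then dual_mul (chi i) (chi j) else chi k].

Lemma carrier_gt0 : (0 < n)%N.
Proof. by apply/card_gt0P; exists 1%g. Qed.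

Lemma supp_eq0 (chi : dualn) : (supp chi == set0) = (chi == [ffun=> 0]).
Proof.
apply/eqP/eqP=> [/setP s0|->]; first apply/ffunP=> i.
  by have := s0 i; rewrite !inE ffunE => /negbFE/eqP.
by apply/setP=> i; rewrite !inE ffunE eqxx.
Qed.

Lemma hat1SE (chi : dualn) : hat1S chi = bij_mean chi * ((n`!)%:R / (n ^ n)%:R).
Proof.
rewrite /hat1S /bij_mean mulrC [RHS]mulrC mulrACA -mulrA.
by rewrite mulrA divff ?mul1r ?pnatr_eq0 -?lt0n ?fact_gt0 // mulrC.
Qed.

Lemma bij_mean0 (chi : dualn) : supp chi = set0 -> bij_mean chi = 1.
Proof.
move=> /setP chi0; rewrite /bij_mean.
rewrite (eq_bigr (fun=> 1)) => [|p _]; last first.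
  rewrite /chiev big1 // => i _; have := chi0 i; rewrite !inE => /negbFE/eqP->.
  by rewrite irr0 cfun1E inE.
rewrite sumr_const /bijS card_inj_ffuns card_ord ffactnn mulVf //.
by rewrite pnatr_eq0 -lt0n fact_gt0.
Qed.

(** On the right chi_j is evaluated at p(i) instead of p(j): this is the term that arises when the
    vanishing sum of chi_j(p(i)) over i is multiplied by the other coordinates. *)
Lemma chiev_merge i j (chi : dualn) (p : 'I_n -> gT) : i != j ->
  chiev (merge i j chi) p = (\prod_(k | k != j) 'chi_(chi k) (p k)) * 'chi_(chi j) (p i).
Proof.
move=> ij; rewrite /chiev (bigD1 j) //= ffunE eqxx irr0 cfun1E inE mul1r.
rewrite (bigD1 i) //= [in RHS](bigD1 i) //= ffunE (negPf ij) eqxx dual_mulE //.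
rewrite cfunE -!mulrA; congr (_ * _); rewrite mulrC; congr (_ * _).
by apply: eq_bigr => k /andP[kj ki]; rewrite ffunE (negPf ki) (negPf kj).
Qed.

(** A trivial chi_i merely swaps places with chi_j, so the move is a transposition of the arguments
    and does not change the mean. *)
Lemma chiev_merge_tperm i j (chi : dualn) (p : {ffun 'I_n -> gT}) : i != j -> chi i = 0 ->
  chiev (merge i j chi) p = chiev chi [ffun k => p (tperm i j k)].
Proof.
move=> ij chii; rewrite chiev_merge // /chiev [in RHS](bigD1 j) //= mulrC.
rewrite ffunE tpermR; congr (_ * _).
rewrite (bigD1 i) //= [in RHS](bigD1 i) //= chii irr0 !cfun1E !inE !mul1r.
apply: eq_bigr => k /andP[kj ki]; rewrite ffunE tpermD //; by rewrite eq_sym.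
Qed.

Lemma bijS_perm (s : {perm 'I_n}) (F : {ffun 'I_n -> gT} -> algC) :
  \sum_(p in bijS gT) F [ffun k => p (s k)] = \sum_(p in bijS gT) F p.
Proof.
pose h (u : {perm 'I_n}) (p : {ffun 'I_n -> gT}) := [ffun k => p (u k)].
have hK u : cancel (h u) (h u^-1%g).
  by move=> p; apply/ffunP=> k; rewrite !ffunE permKV.
have hV u : cancel (h u^-1%g) (h u).
  by move=> p; apply/ffunP=> k; rewrite !ffunE permK.
have inh u (p : {ffun 'I_n -> gT}) : injective p -> injective (h u p).
  by move=> pI x y; rewrite !ffunE => /pI /perm_inj.
rewrite [RHS](reindex (h s)) /=; last by exists (h s^-1%g) => p _; rewrite ?hK ?hV.
apply: eq_bigl => p; rewrite !inE; apply/injectiveP/injectiveP; first exact: inh.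
by rewrite -{2}[p](hK s); apply: inh.
Qed.

Lemma bijS_sum (a : dual) (p : {ffun 'I_n -> gT}) :
  p \in bijS gT -> a != 0 -> \sum_i 'chi_a (p i) = 0.
Proof.
rewrite inE => /injectiveP pI a0; rewrite -[RHS](dual_sum0 a0) [RHS](reindex (p : 'I_n -> gT)) //=.
by apply: onW_bij; apply: (inj_card_bij pI); rewrite card_ord.
Qed.

Lemma bij_mean_rec (chi : dualn) j : j \in supp chi ->
  (n - #|supp chi :\ j|)%:R * bij_mean chi =
  - \sum_(i in supp chi :\ j) bij_mean (merge i j chi).
Proof.
rewrite inE => chij; set D := supp chi :\ j.
pose E i := \sum_(p in bijS gT)
   (\prod_(k | k != j) 'chi_(chi k) (p k)) * 'chi_(chi j) (p i).
have E0 : \sum_i E i = 0.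
  rewrite exchange_big big1 // => p pS.
  by rewrite -mulr_sumr bijS_sum ?mulr0.
(* The indices outside [D] are j itself and the coordinates with trivial character. Each contributes
   the full unmerged sum, whence the factor [n - #|D|]. *)
have Eout i : i \notin D -> E i = \sum_(p in bijS gT) chiev chi p.
  rewrite !inE negb_and negbK; have [-> _|ij /= /negbNE/eqP chii] := eqVneq i j.
    by apply: eq_bigr => p _; rewrite /chiev [RHS](bigD1 j) //= mulrC.
  rewrite -(bijS_perm (tperm i j)); apply: eq_bigr => p _.
  by rewrite -chiev_merge // chiev_merge_tperm.
have Ein i : i \in D -> E i = \sum_(p in bijS gT) chiev (merge i j chi) p.
  by rewrite !inE => /andP[ij _]; apply: eq_bigr => p _; rewrite chiev_merge.
rewrite /bij_mean -mulr_sumr mulrCA -mulrN; congr (_ * _).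
rewrite -(eq_bigr _ Ein); move/eqP: E0; rewrite (bigID (mem D)) /= addrC addr_eq0.
move=> /eqP <-; under [RHS]eq_bigr => i iD do rewrite Eout //.
rewrite sumr_const -[RHS]mulr_natl; congr (_%:R * _).
have <- : #|~: D| = (n - #|D|)%N by rewrite cardsCs setCK card_ord.
by apply: eq_card => i; rewrite in_setC.
Qed.

End Merging.

(** * Elementary inequalities *)

Lemma ler_sum_inj (R : numDomainType) (S T : finType) (P : pred S) (Q : pred T)
    (h : S -> T) (F : T -> R) :
  {in P &, injective h} -> (forall x, P x -> Q (h x)) -> (forall y, 0 <= F y) ->
  \sum_(x | P x) F (h x) <= \sum_(y | Q y) F y.
Proof.
move=> hI hPQ F0; have -> : \sum_(x | P x) F (h x) = \sum_(y in h @: P) F y.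
  by rewrite big_imset.
rewrite big_mkcond [leRHS]big_mkcond; apply: ler_sum => y _.
case: imsetP => [[x Px ->]|_]; first by rewrite hPQ.
by case: ifP.
Qed.

(** The product is at most the square of the larger factor; the usual constant 1/2 is given up,
    since only the order in n matters. *)
Lemma ler_mul_sqrD (R : numDomainType) (x y : R) :
  0 <= x -> 0 <= y -> x * y <= x ^+ 2 + y ^+ 2.
Proof.
move=> x0 y0; have [xy|yx] := real_leP (ger0_real x0) (ger0_real y0).
  by apply: ler_wpDl; rewrite ?exprn_ge0 // expr2 ler_wpM2r.
by apply: ler_wpDr; rewrite ?exprn_ge0 // expr2 ler_wpM2l // ltW.
Qed.

(** Cauchy-Schwarz, up to the factor 2 lost in [ler_mul_sqrD]. *)
Lemma sqr_sum_le (R : numDomainType) (I : finType) (D : {set I}) (x : I -> R) :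
  (forall i, 0 <= x i) ->
  (\sum_(i in D) x i) ^+ 2 <= (2 * #|D|)%:R * \sum_(i in D) x i ^+ 2.
Proof.
move=> x0; rewrite expr2 big_distrlr /=.
apply: (@le_trans _ _ (\sum_(i in D) \sum_(j in D) (x i ^+ 2 + x j ^+ 2))).
  by apply: ler_sum => i _; apply: ler_sum => j _; apply: ler_mul_sqrD.
have inner i : \sum_(j in D) (x i ^+ 2 + x j ^+ 2) =
    x i ^+ 2 *+ #|D| + \sum_(j in D) x j ^+ 2 by rewrite big_split sumr_const.
rewrite (eq_bigr _ (fun i _ => inner i)) big_split /= sumr_const sumrMnl.
by rewrite -mulr2n -mulrnA mulr_natl [(2 * _)%N]mulnC.
Qed.

(** A move lowers the sparsity by at most 2, hence its upper half by at most 1; the factor [q]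
    supplied by the recursion makes up for that. *)
Lemma ler_exp_uphalf (R : numDomainType) (q : R) (k m : nat) :
  0 <= q -> q <= 1 -> (m <= k.+2)%N -> q * q ^+ uphalf k <= q ^+ uphalf m.
Proof.
move=> q0 q1 mk; rewrite -exprS; apply: ler_wiXn2l => //.
exact: (@uphalf_leq m k.+2).
Qed.

(** * Pointwise and square-sum bounds by induction on the sparsity *)

Section Bounds.
Variable gT : finGroupType.
Hypothesis abG : abelian [set: gT].
Local Notation dual := (Iirr [set: gT]).
Local Notation n := #|gT|.
Local Notation dualn := {ffun 'I_n -> dual}.
Local Notation q := (n%:R^-1 : algC).

Lemma inv_card_ge0 : 0 <= q. Proof. by rewrite invr_ge0 ler0n. Qed.

Lemma inv_card_le1 : q <= 1.
Proof. by rewrite invf_le1 ?ltr0n ?carrier_gt0 // ler1n carrier_gt0. Qed.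

Lemma mul_inv_card : q * n%:R = 1.
Proof. by rewrite mulVf // pnatr_eq0 -lt0n carrier_gt0. Qed.

(** Merging forgets only how the product splits, and chi_j determines the split. So a merged
    character has at most n preimages. *)
Lemma merge_inj i j (c d : dualn) : i != j ->
  merge i j c = merge i j d -> c j = d j -> c = d.
Proof.
move=> ij /ffunP cd cdj; apply/ffunP=> k; have := cd k; rewrite !ffunE.
have [->//|_] := eqVneq k j; have [-> e|//] := eqVneq k i.
by rewrite -(dual_mulKV abG (c i) (c j)) e cdj dual_mulKV.
Qed.

Lemma supp_merge (chi : dualn) i j : i \in supp chi -> i != j ->
  chi i != conjC_Iirr (chi j) -> supp (merge i j chi) = supp chi :\ j.
Proof.
rewrite inE => chii ij; rewrite -dual_mul_eq0 // => chiij.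
apply/setP=> k; rewrite !inE ffunE; have [//|kj /=] := eqVneq k j.
by have [->|//] := eqVneq k i; rewrite chiij chii.
Qed.

Lemma supp_mergeV (chi : dualn) i j : i != j ->
  chi i = conjC_Iirr (chi j) -> supp (merge i j chi) = supp chi :\ j :\ i.
Proof.
move=> ij chiij; apply/setP=> k; rewrite !inE ffunE.
have [_|kj /=] := eqVneq k j; first by rewrite eqxx andbF.
by have [->|//] := eqVneq k i; rewrite chiij dual_mulV ?eqxx.
Qed.

Lemma card_supp_merge (chi : dualn) i j :
  j \in supp chi -> i \in supp chi :\ j ->
  (#|supp (merge i j chi)| < #|supp chi| <= #|supp (merge i j chi)|.+2)%N.
Proof.
move=> js /setD1P[ij iS]; have Aj := cardsD1 j (supp chi); rewrite js in Aj.
have Ai := cardsD1 i (supp chi :\ j); rewrite !inE ij -(in_set (fun i => chi i != 0)) iS /= in Ai.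
have [e|ne] := eqVneq (chi i) (conjC_Iirr (chi j)).
  by rewrite supp_mergeV // Aj Ai !add1n leqnn leqnSn.
by rewrite supp_merge // Aj !add1n leqnn leqnSn.
Qed.

(** With k = |A| - 1 < n the claim is n <= (k + 1)(n - k), which follows from n = (n - k) + k and n
    - k >= 1. *)
Lemma inv_factor_le (A : {set 'I_n}) j : j \in A ->
  (n - #|A :\ j|)%:R^-1 <= #|A|%:R * q.
Proof.
move=> jA; have := cardsD1 j A; rewrite jA add1n; set k := #|A :\ j| => Ak.
have kn : (k < n)%N by rewrite -Ak -[leqRHS](card_ord n) max_card.
rewrite ler_pdivlMr ?ltr0n ?carrier_gt0 // mulrC ler_pdivrMr ?ltr0n ?subn_gt0 //.
rewrite -natrM ler_nat Ak mulSn -{1}(subnK (ltnW kn)) leq_add2l.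
by rewrite leq_pmulr // subn_gt0.
Qed.

Lemma bij_mean_le (chi : dualn) j : j \in supp chi ->
  `|bij_mean chi| <= #|supp chi|%:R * q *
     \sum_(i in supp chi :\ j) `|bij_mean (merge i j chi)|.
Proof.
move=> js; set t := (n - #|supp chi :\ j|)%:R : algC.
have t0 : t != 0.
  rewrite pnatr_eq0 -lt0n subn_gt0.
  rewrite -[ltnRHS](card_ord n) (leq_trans _ (max_card (mem (supp chi)))) //.
  by rewrite [leqRHS](cardsD1 j) js.
have -> : bij_mean chi = t^-1 * - \sum_(i in supp chi :\ j) bij_mean (merge i j chi).
  by rewrite -bij_mean_rec // mulKf.
rewrite normrM normrN normfV normr_nat.
by apply: ler_pM; rewrite ?invr_ge0 ?ler0n ?inv_factor_le // ler_norm_sum.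
Qed.

(** Each induction step costs one factor [m.+1] from [inv_factor_le] and at most another for the
    number of moves. *)
Definition sup_const (m : nat) : nat := m`! ^ 2.

(** Here [m] only bounds the sparsity, so that plain induction reaches characters whose sparsity has
    dropped by 1 or by 2. *)
Lemma bij_mean_sup m (chi : dualn) : (#|supp chi| <= m)%N ->
  `|bij_mean chi| <= (sup_const m)%:R * q ^+ uphalf #|supp chi|.
Proof.
have c0 k : (0 < sup_const k)%N by rewrite expn_gt0 fact_gt0.
elim: m chi => [|m IH] chi sm.
  rewrite bij_mean0; last by apply/eqP; rewrite -cards_eq0 -leqn0.
  by move: sm; rewrite leqn0 => /eqP->; rewrite normr1 mulr1 ler1n c0.
have [s0|[j js]] := set_0Vmem (supp chi).
  by rewrite bij_mean0 // s0 cards0 normr1 mulr1 ler1n c0.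
apply: (le_trans (bij_mean_le js)); set A := supp chi.
have Am : (#|A :\ j| <= m.+1)%N by rewrite (leq_trans _ sm) // subset_leq_card ?subsetDl.
(* The worst case, a drop by 2, loses a factor n in the induction hypothesis; it cancels the [q] in
   front. *)
apply: (@le_trans _ _ (m.+1%:R * q * \sum_(i in A :\ j)
   ((sup_const m)%:R * (q ^+ uphalf #|A| * n%:R)))).
  apply: ler_pM; rewrite ?mulr_ge0 ?ler0n ?inv_card_ge0 ?sumr_ge0 //.
    by rewrite ler_wpM2r ?inv_card_ge0 ?ler_nat.
  apply: ler_sum => i iA; have /andP[c1 c2] := card_supp_merge js iA.
  apply: (le_trans (IH _ _)); first by rewrite -ltnS (leq_trans c1).
  rewrite ler_wpM2l ?ler0n // -ler_pdivrMr ?ltr0n ?carrier_gt0 // mulrC.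
  by rewrite ler_exp_uphalf ?inv_card_ge0 ?inv_card_le1.
have -> : m.+1%:R * q * \sum_(i in A :\ j)
      ((sup_const m)%:R * (q ^+ uphalf #|A| * n%:R)) =
    (m.+1 * #|A :\ j| * sup_const m)%:R * q ^+ uphalf #|A| * (q * n%:R).
  have rearrange (R : comPzRingType) (a b c r x y : R) :
    a * r * (b * (c * (x * y))) = a * b * c * x * (r * y) by ring.
  by rewrite sumr_const -[_ *+ #|_|]mulr_natl !natrM rearrange.
rewrite mul_inv_card mulr1 ler_wpM2r ?exprn_ge0 ?inv_card_ge0 //.
by rewrite ler_nat /sup_const factS expnMn leq_mul2r leq_mul ?orbT.
Qed.

Definition energy (A : {set 'I_n}) : algC :=
  \sum_(chi : dualn | supp chi == A) `|bij_mean chi| ^+ 2.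

(** Split by the value of chi_j: merging is injective on each of the n classes. *)
Lemma sum_merge_le (P : pred dualn) (B : {set 'I_n}) i j : i != j ->
  (forall chi, P chi -> supp (merge i j chi) = B) ->
  \sum_(chi | P chi) `|bij_mean (merge i j chi)| ^+ 2 <= n%:R * energy B.
Proof.
move=> ij PB; rewrite (partition_big (fun chi : dualn => chi j) predT) //=.
have -> : n%:R * energy B = \sum_(a : dual) energy B.
  by rewrite sumr_const card_Iirr_abelian // cardsT mulr_natl.
apply: ler_sum => a _.
apply: (ler_sum_inj (F := fun c : dualn => `|bij_mean c| ^+ 2)) => [c d|c|c].
- move=> /andP[_ /eqP ca] /andP[_ /eqP da] e.
  by apply: (merge_inj ij e); rewrite ca da.
- by case/andP=> Pc _; apply/eqP/PB.
- by rewrite exprn_ge0.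
Qed.

Lemma sum_merge_energy_le (A : {set 'I_n}) i j : i \in A :\ j ->
  \sum_(chi : dualn | supp chi == A) `|bij_mean (merge i j chi)| ^+ 2
    <= n%:R * (energy (A :\ j) + energy (A :\ j :\ i)).
Proof.
move=> /setD1P[ij iA]; rewrite mulrDr addrC.
rewrite (bigID (fun chi : dualn => chi i == conjC_Iirr (chi j))) /= lerD //.
  by apply: sum_merge_le => // chi /andP[/eqP<- /eqP]; apply: supp_mergeV.
apply: sum_merge_le => // chi /andP[/eqP sA ne].
by rewrite supp_merge ?sA // iA.
Qed.

(** Each step multiplies by 4 (m+1)^5: (m+1)^2 from the squared coefficient, 2(m+1) from
    [sqr_sum_le], 2 for the two kinds of move, and a generous (m+1)^2 for the number of moves. *)
Definition energy_const (m : nat) : nat := 4 ^ m * m`! ^ 5.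

(** Summing the pointwise bound over all characters with support [A] would only give O(1). In the
    squared recursion the gain [q ^+ 2] pays for one factor n from the freedom of chi_j and one from
    the drop in sparsity. *)
Lemma energy_le m (A : {set 'I_n}) : (#|A| <= m)%N ->
  energy A <= (energy_const m)%:R * q ^+ uphalf #|A|.
Proof.
have c0 k : (0 < energy_const k)%N by rewrite muln_gt0 !expn_gt0 fact_gt0.
have e0 : energy set0 = 1.
  rewrite /energy (big_pred1 [ffun=> 0]) => [|chi]; last exact: supp_eq0.
  by rewrite bij_mean0 ?normr1 ?expr1n //; apply/eqP; rewrite supp_eq0.
elim: m A => [|m IH] A sm.
  move: sm; rewrite leqn0 cards_eq0 => /eqP->.
  by rewrite e0 cards0 mulr1 ler1n c0.
have [->|[j jA]] := set_0Vmem A; first by rewrite e0 cards0 mulr1 ler1n c0.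
have Aj := cardsD1 j A; rewrite jA add1n in Aj.
have Am : (#|A :\ j| <= m)%N by rewrite -ltnS -Aj.
have pointwise chi : supp chi = A -> `|bij_mean chi| ^+ 2 <=
    (m.+1%:R * q) ^+ 2 * ((2 * m.+1)%:R *
      \sum_(i in A :\ j) `|bij_mean (merge i j chi)| ^+ 2).
  move=> sA; have := bij_mean_le (chi := chi) (j := j); rewrite sA => /(_ jA) H.
  apply: (@le_trans _ _ ((m.+1%:R * q * \sum_(i in A :\ j) `|bij_mean (merge i j chi)|) ^+ 2)).
    apply: lerXn2r; rewrite ?nnegrE ?mulr_ge0 ?ler0n ?inv_card_ge0 ?sumr_ge0 //.
    apply: (le_trans H); rewrite ler_wpM2r ?sumr_ge0 //.
    by rewrite ler_wpM2r ?inv_card_ge0 // ler_nat.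
  rewrite exprMn ler_wpM2l ?exprn_ge0 ?mulr_ge0 ?ler0n ?inv_card_ge0 //.
  apply: le_trans (sqr_sum_le _ _) _ => //.
  rewrite ler_wpM2r ?sumr_ge0 // => [i _|]; first by rewrite exprn_ge0.
  by rewrite ler_nat leq_mul2l (leq_trans Am).
apply: (le_trans (ler_sum _ (fun chi sA => pointwise chi (eqP sA)))).
rewrite -!mulr_sumr exchange_big /=.
set c := (energy_const m)%:R : algC.
apply: (@le_trans _ _ ((m.+1%:R * q) ^+ 2 * ((2 * m.+1)%:R *
   \sum_(i in A :\ j) (n%:R * (c * (q ^+ uphalf #|A| * n%:R) *+ 2))))).
  rewrite ler_wpM2l ?exprn_ge0 ?mulr_ge0 ?ler0n ?inv_card_ge0 // ler_wpM2l ?ler0n //.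
  apply: ler_sum => i iA; apply: (le_trans (sum_merge_energy_le iA)).
  have Ai := cardsD1 i (A :\ j); rewrite iA add1n in Ai.
  rewrite ler_wpM2l ?ler0n // mulr2n; apply: lerD.
    apply: (le_trans (IH _ Am)); rewrite ler_wpM2l ?ler0n //.
    rewrite -ler_pdivrMr ?ltr0n ?carrier_gt0 // mulrC.
    by rewrite ler_exp_uphalf ?inv_card_ge0 ?inv_card_le1 // Aj.
  apply: (le_trans (IH _ _)); first by rewrite (leq_trans _ Am) // Ai.
  rewrite ler_wpM2l ?ler0n // -ler_pdivrMr ?ltr0n ?carrier_gt0 // mulrC.
  by rewrite ler_exp_uphalf ?inv_card_ge0 ?inv_card_le1 // Aj Ai.
rewrite sumr_const.
have -> : (m.+1%:R * q) ^+ 2 * ((2 * m.+1)%:R *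
   ((n%:R * (c * (q ^+ uphalf #|A| * n%:R) *+ 2)) *+ #|A :\ j|)) =
   (m.+1 ^ 2 * (2 * m.+1) * 2 * #|A :\ j|)%:R * c * q ^+ uphalf #|A| * (q * n%:R) ^+ 2.
  have rearrange (R : comPzRingType) (a b d r x y w : R) :
    (a * r) ^+ 2 * (d * a * (w * (y * (2%:R * (b * (x * y)))))) =
    a ^+ 2 * (d * a) * 2%:R * w * b * x * (r * y) ^+ 2 by ring.
  rewrite -[_ *+ #|_|]mulr_natl -[_ *+ 2]mulr_natl.
  by rewrite !natrM rearrange expr2.
rewrite mul_inv_card expr1n mulr1 -natrM ler_wpM2r ?exprn_ge0 ?inv_card_ge0 // ler_nat.
rewrite /energy_const factS expnMn (expnS 4).
set x := m.+1; have -> : (4 * 4 ^ m * (x ^ 5 * m`! ^ 5) =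
   (x ^ 2 * (2 * x) * 2 * (x * x)) * (4 ^ m * m`! ^ 5))%N.
  by rewrite !expnS !expn0; ring.
rewrite leq_mul2r; apply/orP; right; rewrite leq_mul //.
by rewrite (leq_trans Am) // /x (leq_trans (leqnSn m)) // leq_pmulr.
Qed.

End Bounds.

(** * The cube of a sum, approximated by its dominant diagonal terms *)

Section CubeOfSum.
Variables (R : numDomainType) (I : finType) (D E : {set I}) (y : I -> R).
Variables sigma tau : R.
Hypotheses (sED : E \subset D) (sigma0 : 0 <= sigma) (tau0 : 0 <= tau).
Hypothesis y_sigma : forall i, i \in D :\: E -> `|y i| <= sigma.
Hypothesis y_tau : forall i, i \in E -> `|y i| <= tau.

Let sum_norm_le (B : {set I}) c :
  (forall i, i \in B -> `|y i| <= c) -> `|\sum_(i in B) y i| <= #|B|%:R * c.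
Proof.
move=> yB; apply: (le_trans (ler_norm_sum _ _ _)).
by rewrite mulr_natl -sumr_const; apply: ler_sum.
Qed.

Let sqr_norm_sum_le (B : {set I}) : B \subset D ->
  `|\sum_(i in B) y i| ^+ 2 <= (2 * #|D|)%:R * \sum_(i in D) `|y i| ^+ 2.
Proof.
move=> BD; apply: le_trans (sqr_sum_le D (fun i => normr_ge0 (y i))).
apply: lerXn2r; rewrite ?nnegrE ?sumr_ge0 //.
apply: (le_trans (ler_norm_sum _ _ _)); rewrite [leRHS](big_setID B) /=.
by rewrite (setIidPr BD) ler_wpDr ?sumr_ge0.
Qed.

(** Since v^2 - y_i^2 = (v - y_i)(v + y_i), the difference is the sum of y_i y_k (v + y_i) over
    ordered pairs of distinct i, k. The last factor is at most (|E| + 1) [tau], and the squares of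
    y_i and y_k contribute equally by symmetry. *)
Let cube_diag_le :
  `|(\sum_(i in E) y i) ^+ 3 - \sum_(i in E) y i ^+ 3| <=
    (2 * #|E|.+1)%:R * (tau * \sum_(i in E) \sum_(k in E :\ i) `|y i| ^+ 2).
Proof.
set v := \sum_(i in E) y i.
have -> : v ^+ 3 - \sum_(i in E) y i ^+ 3 =
    \sum_(i in E) \sum_(k in E :\ i) y i * y k * (v + y i).
  have -> : v ^+ 3 = \sum_(i in E) y i * v ^+ 2 by rewrite exprS mulr_suml.
  rewrite -sumrB; apply: eq_bigr => i iE.
  have vi : \sum_(k in E :\ i) y k = v - y i.
    by rewrite /v [in RHS](big_setD1 i) //= [RHS]addrC addKr.
  by rewrite -mulr_suml -mulr_sumr vi; ring.
apply: (@le_trans _ _ (\sum_(i in E) \sum_(k in E :\ i)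
    (`|y i| ^+ 2 + `|y k| ^+ 2) * (#|E|.+1%:R * tau))).
  apply: (le_trans (ler_norm_sum _ _ _)); apply: ler_sum => i iE.
  apply: (le_trans (ler_norm_sum _ _ _)); apply: ler_sum => k _.
  rewrite !normrM; apply: ler_pM; rewrite ?mulr_ge0 //; first exact: ler_mul_sqrD.
  apply: (le_trans (ler_normD _ _)); rewrite -natr1 mulrDl mul1r lerD ?y_tau //.
  exact: sum_norm_le.
under eq_bigr => i _ do rewrite -mulr_suml big_split /=.
rewrite -mulr_suml big_split /=.
rewrite [X in _ + X](exchange_big_dep (mem E)) /=; last by move=> i k _ /setD1P[].
have -> : \sum_(k in E) \sum_(i in E | k \in E :\ i) `|y k| ^+ 2 =
          \sum_(i in E) \sum_(k in E :\ i) `|y i| ^+ 2.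
  apply: eq_bigr => i iE; apply: eq_bigl => k.
  by rewrite !inE iE andbT andbC eq_sym.
by rewrite natrM -mulr2n -mulr_natl le_eqVlt; apply/orP; left; apply/eqP; ring.
Qed.

(* Every other cubic monomial has a factor outside [E], or two distinct factors
   in [E]: bound one factor by [sigma] or [tau], the other two by their squares. *)
Lemma cube_sum_approx :
  `|(\sum_(i in D) y i) ^+ 3 - \sum_(i in E) y i ^+ 3| <=
    (20 * #|D|.+1 ^ 2)%:R * (sigma * \sum_(i in D) `|y i| ^+ 2
      + tau * \sum_(i in E) \sum_(k in E :\ i) `|y i| ^+ 2).
Proof.
set Y := \sum_(i in D) `|y i| ^+ 2; set Z := \sum_(i in E) _.
have Y0 : 0 <= Y by rewrite sumr_ge0 // => i _; rewrite exprn_ge0.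
have Z0 : 0 <= Z.
  by rewrite sumr_ge0 // => i _; rewrite sumr_ge0 // => k _; rewrite exprn_ge0.
set u := \sum_(i in D :\: E) y i; set v := \sum_(i in E) y i.
have -> : \sum_(i in D) y i = v + u by rewrite (big_setID E) /= (setIidPr sED).
have -> : (v + u) ^+ 3 - \sum_(i in E) y i ^+ 3 =
   u * (u ^+ 2 + 3%:R * (u * v) + 3%:R * v ^+ 2) + (v ^+ 3 - \sum_(i in E) y i ^+ 3).
  by ring.
apply: (le_trans (ler_normD _ _)); rewrite [leRHS]mulrDr; apply: lerD; last first.
  apply: (le_trans cube_diag_le); rewrite ler_wpM2r ?mulr_ge0 // ler_nat leq_mul //.
  apply: (@leq_trans #|D|.+1); first by rewrite ltnS subset_leq_card.
  by rewrite expnS expn1 leq_pmulr.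
have uY := sqr_norm_sum_le (subsetDl D E); have vY := sqr_norm_sum_le sED.
rewrite -/u -/v -/Y in uY vY.
rewrite normrM; apply: (@le_trans _ _ ((#|D|%:R * sigma) * (20 * #|D|)%:R * Y)); last first.
  have -> : #|D|%:R * sigma * (20 * #|D|)%:R * Y = (20 * #|D| ^ 2)%:R * (sigma * Y).
    by rewrite !natrM; ring.
  by rewrite ler_wpM2r ?mulr_ge0 // ler_nat leq_mul2l leq_exp2r // leqnSn.
rewrite -mulrA; apply: ler_pM => //.
  apply: (le_trans (sum_norm_le y_sigma)).
  by rewrite ler_wpM2r // ler_nat subset_leq_card // subsetDl.
(* Bounding |u||v| by |u|^2 + |v|^2 turns the quadratic factor into 4|u|^2 + 6|v|^2, and each square
   is at most 2|D| [Y]: hence 20. *)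
have -> : (20 * #|D|)%:R * Y = 4%:R * ((2 * #|D|)%:R * Y) + 6%:R * ((2 * #|D|)%:R * Y).
  by rewrite !natrM; ring.
apply: (@le_trans _ _ (4%:R * `|u| ^+ 2 + 6%:R * `|v| ^+ 2)); last first.
  by apply: lerD; rewrite ler_wpM2l ?ler0n.
have -> : 4%:R * `|u| ^+ 2 + 6%:R * `|v| ^+ 2 =
  `|u| ^+ 2 + 3%:R * (`|u| ^+ 2 + `|v| ^+ 2) + 3%:R * `|v| ^+ 2 by ring.
apply: (le_trans (ler_normD _ _)); apply: lerD; last by rewrite normrM normr_nat normrX.
apply: (le_trans (ler_normD _ _)); apply: lerD; first by rewrite normrX.
by rewrite normrM normr_nat normrM ler_wpM2l ?ler0n // ler_mul_sqrD.
Qed.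

End CubeOfSum.

(** This is N^3 - T^3 = s(N^2 + NT + T^2) divided by N^2 T^3. It will compare the exact coefficient
    of the cubed recursion with its limiting form. *)
Lemma inv_cube_approx (R : numFieldType) (N T s M : nat) :
  (0 < T)%N -> N = (T + s)%N -> (T%:R^-1 : R) <= M%:R * N%:R^-1 ->
  `|N%:R * T%:R^-1 ^+ 3 - N%:R^-1 ^+ 2| <= (3 * s * M.+1 ^ 3)%:R * (N%:R^-1 : R) ^+ 3.
Proof.
move=> T0 Ns; set x := T%:R^-1; set r := N%:R^-1 => xM.
have N0 : (0 < N)%N by rewrite Ns addn_gt0 T0.
have r0 : 0 <= r by rewrite invr_ge0 ler0n.
have x0 : 0 <= x by rewrite invr_ge0 ler0n.
have Tx : T%:R * x = 1 by rewrite mulfV // pnatr_eq0 -lt0n.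
have Nr : N%:R * r = 1 by rewrite mulfV // pnatr_eq0 -lt0n.
have NT : (N%:R : R) = T%:R + s%:R by rewrite Ns natrD.
have -> : N%:R * x ^+ 3 - r ^+ 2 = s%:R * (x * (x * x) + x * (r * x) + x * (r * r)).
  have -> : (s%:R : R) = N%:R - T%:R by rewrite NT addrC addKr.
  have -> : (N%:R - T%:R) * (x * (x * x) + x * (r * x) + x * (r * r)) =
    N%:R * x ^+ 3 + (N%:R * r) * (x ^+ 2 + r * x)
     - (T%:R * x) * (x ^+ 2 + r * x + r ^+ 2) by ring.
  by rewrite Nr Tx; ring.
rewrite ger0_norm ?mulr_ge0 ?addr_ge0 ?mulr_ge0 //.
have xM' : x <= M.+1%:R * r by rewrite (le_trans xM) // ler_wpM2r // ler_nat.
have rM' : r <= M.+1%:R * r by rewrite ler_peMl // ler1n.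
have -> : (3 * s * M.+1 ^ 3)%:R * r ^+ 3 = s%:R * ((M.+1%:R * r) * ((M.+1%:R * r) * (M.+1%:R * r))
   + (M.+1%:R * r) * ((M.+1%:R * r) * (M.+1%:R * r))
   + (M.+1%:R * r) * ((M.+1%:R * r) * (M.+1%:R * r))) :> R.
  by rewrite !natrM; ring.
by rewrite ler_wpM2l ?ler0n //; do 2?apply: lerD; do 2![apply: ler_pM; rewrite ?mulr_ge0 //].
Qed.

(** * Cubic sums over the characters with a fixed support *)

Section SupportSums.
Variable gT : finGroupType.
Hypothesis abG : abelian [set: gT].
Local Notation dual := (Iirr [set: gT]).
Local Notation n := #|gT|.
Local Notation dualn := {ffun 'I_n -> dual}.
Local Notation q := (n%:R^-1 : algC).
Variable f : 'I_n -> gT.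

Definition supp_sum (A : {set 'I_n}) : algC :=
  \sum_(chi : dualn | supp chi == A) bij_mean chi ^+ 3 * chiev chi f.

Lemma norm_chiev (chi : dualn) : `|chiev chi f| = 1.
Proof. by rewrite normr_prod big1 // => i _; rewrite normC_dual. Qed.

(** One factor is bounded pointwise, the other two by [energy]. *)
Lemma sum_cube_le (A : {set 'I_n}) :
  \sum_(chi : dualn | supp chi == A) `|bij_mean chi| ^+ 3 <=
    (sup_const #|A| * energy_const #|A|)%:R * q ^+ (uphalf #|A|).*2.
Proof.
have q0 := inv_card_ge0 gT.
apply: (@le_trans _ _ ((sup_const #|A|)%:R * q ^+ uphalf #|A| * energy A)).
  rewrite mulr_sumr; apply: ler_sum => chi /eqP <-.
  by rewrite exprS ler_wpM2r ?exprn_ge0 ?bij_mean_sup.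
have -> : (sup_const #|A| * energy_const #|A|)%:R * q ^+ (uphalf #|A|).*2 =
    (sup_const #|A|)%:R * q ^+ uphalf #|A| *
    ((energy_const #|A|)%:R * q ^+ uphalf #|A|).
  by rewrite -addnn exprD natrM mulrACA.
by rewrite ler_wpM2l ?mulr_ge0 ?ler0n ?exprn_ge0 ?energy_le.
Qed.

Lemma norm_supp_sum_le (A : {set 'I_n}) :
  `|supp_sum A| <= (sup_const #|A| * energy_const #|A|)%:R * q ^+ (uphalf #|A|).*2.
Proof.
apply: le_trans (sum_cube_le A); apply: (le_trans (ler_norm_sum _ _ _)).
by apply: ler_sum => chi _; rewrite normrM norm_chiev mulr1 normrX.
Qed.

(** A right inverse of [merge] on characters trivial at i and j, producing opposite characters
    there; it takes a pair so that a double sum can be reindexed along it. *)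
Definition split_pair i j (u : dual * dualn) : dualn :=
  [ffun k => if k == j then u.1
             else if k == i then conjC_Iirr u.1 else u.2 k].

Lemma merge_split_pair i j a (c : dualn) : i != j -> c i = 0 -> c j = 0 ->
  merge i j (split_pair i j (a, c)) = c.
Proof.
move=> ij ci cj; apply/ffunP=> k; rewrite !ffunE.
have [->|kj] := eqVneq k j; first by rewrite cj.
have [->|ki //] := eqVneq k i.
by rewrite !eqxx (negPf ij) dual_mulV // ci.
Qed.

Lemma split_pair_merge i j (c : dualn) : i != j -> c i = conjC_Iirr (c j) ->
  split_pair i j (c j, merge i j c) = c.
Proof.
move=> ij ci; apply/ffunP=> k; rewrite !ffunE /=.
have [->//|kj] := eqVneq k j; have [->//|ki //] := eqVneq k i.
Qed.

Lemma chiev_split_pair i j a (c : dualn) : i != j -> c i = 0 -> c j = 0 ->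
  chiev (split_pair i j (a, c)) f = 'chi_a (f j) * ('chi_a (f i))^* * chiev c f.
Proof.
move=> ij ci cj; rewrite /chiev (bigD1 j) //= (bigD1 i) //= mulrA !ffunE !eqxx.
rewrite (negPf ij) conjC_IirrE cfunE /=; congr (_ * _).
rewrite [RHS](bigD1 j) //= [in RHS](bigD1 i) //= ci cj irr0 !cfun1E !inE !mul1r.
by apply: eq_bigr => k /andP[kj ki]; rewrite ffunE (negPf ki) (negPf kj).
Qed.

(** The characters on the left are the [split_pair] of a nontrivial [a] and a [c] supported on the
    rest of [A]. The mean depends on [c] alone, and the sum over [a] is the orthogonality relation
    with the trivial character removed. *)
Lemma sum_cancelling_pair (A : {set 'I_n}) i j : j \in A -> i \in A :\ j ->
  \sum_(chi : dualn | (supp chi == A) && (chi i == conjC_Iirr (chi j)))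
     bij_mean (merge i j chi) ^+ 3 * chiev chi f =
  ((n * (f i == f j))%:R - 1) * supp_sum (A :\ j :\ i).
Proof.
move=> jA /setD1P[ij iA]; set B := A :\ j :\ i.
have -> : (n * (f i == f j))%:R - 1 =
    \sum_(a : dual | a != 0) 'chi_a (f j) * ('chi_a (f i))^*.
  have := dual_orthogonality abG (f j) (f i); rewrite (bigD1 0) //= irr0.
  by rewrite !cfun1E !inE conjC1 mulr1 eq_sym => <-; rewrite addrAC subrr add0r.
rewrite mulr_suml; under [RHS]eq_bigr => a _ do rewrite mulr_sumr.
rewrite pair_big /=.
rewrite (reindex_onto (split_pair i j) (fun c => (c j, merge i j c))) /=; last first.
  by move=> c /andP[_ /eqP ci]; apply: split_pair_merge.
have Bz (c : dualn) : supp c = B -> c i = 0 /\ c j = 0.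
  by move=> /setP cB; split; apply/eqP; [have := cB i | have := cB j];
     rewrite !inE eqxx ?andbF //= => /negbFE.
apply: eq_big => [[a c]|[a c]] /=.
  (* The round-trip condition of the reindexing, that merging returns [c], is exchanged for the
     condition that [c] has support [B]. *)
  apply/idP/idP.
    case/andP=> /andP[/eqP sA /eqP ci] /eqP[_ e].
    have <- : supp (split_pair i j (a, c)) :\ j :\ i = supp c.
      by rewrite -(supp_mergeV abG ij ci) e.
    have := jA; rewrite -sA inE ffunE eqxx /= => ->.
    by rewrite sA /= eqxx.
  case/andP=> a0 /eqP cB; have [ci cj] := Bz _ cB.
  rewrite merge_split_pair // !ffunE !eqxx (negPf ij) !eqxx !andbT /=.
  apply/eqP/setP=> k; rewrite inE ffunE /=.
  have [->|kj] := eqVneq k j; first by rewrite a0 jA.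
  have [->|ki] := eqVneq k i.
    by rewrite iA conjC_Iirr_eq0.
  by move/setP: cB => /(_ k); rewrite !inE kj ki.
case/andP=> /andP[/eqP sA /eqP ci] /eqP[_ e].
have cB : supp c = B by rewrite -e supp_mergeV // sA.
have [ci0 cj0] := Bz _ cB.
by rewrite e chiev_split_pair // mulrCA mulrA.
Qed.

End SupportSums.

(** * Removing a pair of opposite coordinates from an even support *)

Lemma uphalf_doubleS h : uphalf h.*2.+1 = h.+1.
Proof. by rewrite uphalfE /= doubleK. Qed.

Section PairingRecursion.
Variable gT : finGroupType.
Hypothesis abG : abelian [set: gT].
Local Notation dual := (Iirr [set: gT]).
Local Notation n := #|gT|.
Local Notation dualn := {ffun 'I_n -> dual}.
Local Notation q := (n%:R^-1 : algC).
Variable f : 'I_n -> gT.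
Variables (h : nat) (A : {set 'I_n}) (j : 'I_n).
Hypotheses (jA : j \in A) (cardA : #|A| = h.*2.+2).

Let D := A :\ j.
Let x := ((n - #|D|)%:R^-1 : algC).
Let y (chi : dualn) i := bij_mean (merge i j chi).
(** The cancelling moves, which lower the sparsity by 2 and carry the main term. *)
Let E (chi : dualn) : {set 'I_n} := [set i in D | chi i == conjC_Iirr (chi j)].
Let c2 := energy_const h.*2.+1.

Let cardD : #|D| = h.*2.+1.
Proof. by have := cardsD1 j A; rewrite jA cardA add1n => -[]. Qed.

Let cardDi i : i \in D -> #|D :\ i| = h.*2.
Proof. by move=> iD; have := cardsD1 i D; rewrite iD cardD add1n => -[]. Qed.

Let neqD i : i \in D -> i != j. Proof. by case/setD1P. Qed.

Let energy_D i : i \in D -> energy D + energy (D :\ i) <= (2 * c2)%:R * q ^+ h.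
Proof.
move=> iD; rewrite natrM -mulrA mulr_natl mulr2n; apply: lerD.
  apply: (le_trans (energy_le abG (m := h.*2.+1) _)); first by rewrite cardD.
  rewrite ler_wpM2l ?ler0n // cardD uphalf_doubleS.
  by apply: ler_wiXn2l; rewrite ?inv_card_ge0 ?inv_card_le1.
apply: (le_trans (energy_le abG (m := h.*2.+1) _)); first by rewrite cardDi.
by rewrite cardDi // uphalf_double.
Qed.

Let sum_sqr_merge :
  \sum_(chi : dualn | supp chi == A) \sum_(i in D) `|y chi i| ^+ 2 <=
    (h.*2.+1 * (2 * c2))%:R * (n%:R * q ^+ h).
Proof.
rewrite exchange_big /= natrM -mulrA mulr_natl -cardD -sumr_const.
apply: ler_sum => i iD; apply: (le_trans (sum_merge_energy_le abG iD)).
by rewrite mulrCA ler_wpM2l ?ler0n ?energy_D.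
Qed.

(* Two coordinates opposite to [chi j] leave no freedom in [chi j] once the
   merged character is known, which saves a factor [n]. *)
Let sum_sqr_double_merge :
  \sum_(chi : dualn | supp chi == A) \sum_(i in E chi) \sum_(k in E chi :\ i)
     `|y chi i| ^+ 2 <= (h.*2.+1 ^ 2 * c2)%:R * q ^+ h.
Proof.
pose P (chi : dualn) i := chi i == conjC_Iirr (chi j).
have -> : \sum_(chi : dualn | supp chi == A) \sum_(i in E chi)
      \sum_(k in E chi :\ i) `|y chi i| ^+ 2 =
    \sum_(i in D) \sum_(k in D :\ i) \sum_(chi : dualn | supp chi == A)
      (if P chi i && P chi k then `|y chi i| ^+ 2 else 0).
  under [RHS]eq_bigr => i _ do rewrite exchange_big /=.
  rewrite [RHS]exchange_big /=; apply: eq_bigr => chi _.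
  rewrite big_mkcond [RHS]big_mkcond; apply: eq_bigr => i _.
  rewrite inE -/(P chi i); case: (i \in D) => //=.
  case Pi: (P chi i) => /=; last by rewrite big1.
  rewrite big_mkcond [RHS]big_mkcond; apply: eq_bigr => k _.
  by rewrite !inE -/(P chi k); case: (k == i); case: (k == j); case: (k \in A); case: (P chi k).
have -> : (h.*2.+1 ^ 2 * c2)%:R * q ^+ h =
    \sum_(i in D) (\sum_(k in D) c2%:R * q ^+ h).
  rewrite !sumr_const cardD -mulrnA -[RHS]mulr_natl natrM mulrA.
  by rewrite -natrM mulnC.
apply: ler_sum => i iD; rewrite [leRHS](big_setD1 i) //= ler_wpDl //.
  by rewrite mulr_ge0 ?ler0n ?exprn_ge0 ?inv_card_ge0.
apply: ler_sum => k /setD1P[ki kD]; rewrite -big_mkcondr.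
apply: (@le_trans _ _ (energy (D :\ i))); last first.
  apply: (le_trans (energy_le abG (m := h.*2.+1) _)); first by rewrite cardDi.
  by rewrite cardDi // uphalf_double.
have ij := neqD iD; have kj := neqD kD.
apply: (ler_sum_inj (F := fun c : dualn => `|bij_mean c| ^+ 2)) => [c d|c|c].
- case/and3P=> _ _ /eqP ck /and3P[_ _ /eqP dk] e.
  (* Coordinate [k] is untouched by the merge and holds the inverse of chi_j, so chi_j can be read
     off there. *)
  apply: (merge_inj abG ij e); apply: (can_inj (@conjC_IirrK _ _)).
  by move/ffunP: e => /(_ k); rewrite !ffunE (negPf kj) (negPf ki) -ck -dk.
- by case/and3P=> /eqP sA /eqP ci _; rewrite supp_mergeV // sA.
- by rewrite exprn_ge0.
Qed.

(** With d = [m.+1] the size of [D]: the constant of [cube_sum_approx], the pointwise and energy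
    constants, then 2d from [sum_sqr_merge] and d^2 from [sum_sqr_double_merge]. *)
Definition cube_const (m : nat) : nat :=
  20 * m.+2 ^ 2 * (sup_const m.+1 * energy_const m.+1 * (2 * m.+1 + m.+1 ^ 2)).

(** Non-cancelling moves pair a pointwise bound of order q^(h+1) with a sum of squares of order n
    q^h; two distinct cancelling moves pair q^h with q^h. Both give q^(2h), whereas the cancelling
    cubes may reach n q^(2h). *)
Let sum_cube_error :
  \sum_(chi : dualn | supp chi == A)
     `|(\sum_(i in D) y chi i) ^+ 3 - \sum_(i in E chi) y chi i ^+ 3| <=
   (cube_const h.*2)%:R * q ^+ h.*2.
Proof.
set c1 := sup_const h.*2.+1.
have q0 := inv_card_ge0 gT; have q1 := inv_card_le1 gT.
have c1h k : 0 <= c1%:R * q ^+ k by rewrite mulr_ge0 ?ler0n ?exprn_ge0.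
have ysup chi i : supp chi = A -> i \in D -> i \notin E chi ->
    `|y chi i| <= c1%:R * q ^+ h.+1.
  move=> sA iD; rewrite inE iD /= => ne.
  have sm : supp (merge i j chi) = D.
    by rewrite supp_merge ?sA ?neqD //; case/setD1P: iD.
  by have := @bij_mean_sup _ abG h.*2.+1 (merge i j chi); rewrite sm cardD uphalf_doubleS; apply.
have ysupE chi i : supp chi = A -> i \in E chi -> `|y chi i| <= c1%:R * q ^+ h.
  move=> sA; rewrite inE => /andP[iD /eqP ci].
  have sm : supp (merge i j chi) = D :\ i by rewrite supp_mergeV ?sA ?neqD.
  have := @bij_mean_sup _ abG h.*2.+1 (merge i j chi).
  by rewrite sm cardDi // uphalf_double; apply.
have ED chi : E chi \subset D by apply/subsetP=> i; rewrite inE => /andP[].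
apply: (@le_trans _ _ (\sum_(chi : dualn | supp chi == A)
   (20 * #|D|.+1 ^ 2)%:R * (c1%:R * q ^+ h.+1 * \sum_(i in D) `|y chi i| ^+ 2
      + c1%:R * q ^+ h * \sum_(i in E chi) \sum_(k in E chi :\ i) `|y chi i| ^+ 2))).
  apply: ler_sum => chi /eqP sA; apply: cube_sum_approx => // i.
    by case/setDP=> iD iE; apply: ysup.
  exact: ysupE.
rewrite -mulr_sumr big_split /= -!mulr_sumr cardD.
have -> : (cube_const h.*2)%:R * q ^+ h.*2 = (20 * h.*2.+2 ^ 2)%:R *
   (c1%:R * q ^+ h.+1 * ((h.*2.+1 * (2 * c2))%:R * (n%:R * q ^+ h))
    + c1%:R * q ^+ h * ((h.*2.+1 ^ 2 * c2)%:R * q ^+ h)).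
  rewrite -[in q ^+ _]addnn exprD exprS.
  have regroup (R : comPzRingType) (K b c d : nat) (r z w : R) : z * w = 1 ->
    (K * (b * c * (2 * d + d ^ 2)))%:R * (r * r) = K%:R *
      (b%:R * (z * r) * ((d * (2 * c))%:R * (w * r)) + b%:R * r * ((d ^ 2 * c)%:R * r)).
    move=> zw; rewrite !natrM natrD !natrM.
    have -> : K%:R * (b%:R * (z * r) * (d%:R * (2%:R * c%:R) * (w * r))
        + b%:R * r * (d%:R * d%:R * c%:R * r)) =
      K%:R * (b%:R * c%:R * (2%:R * d%:R * (z * w) + d%:R * d%:R)) * (r * r) by ring.
    by rewrite zw mulr1.
  by apply: regroup; exact: mul_inv_card.
by rewrite ler_wpM2l ?ler0n // lerD // ler_wpM2l.
Qed.

Let D_lt : (#|D| < n)%N.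
Proof. by rewrite cardD -cardA -[leqRHS](card_ord n) max_card. Qed.

Let x_ge0 : 0 <= x. Proof. by rewrite invr_ge0 ler0n. Qed.

Let x_le : x <= h.*2.+2%:R * q.
Proof. by rewrite -cardA; apply: inv_factor_le. Qed.

Let x_cube_le : x ^+ 3 <= (h.*2.+2 ^ 3)%:R * q ^+ 3.
Proof. by rewrite natrX -exprMn lerXn2r ?nnegrE ?mulr_ge0 ?ler0n ?inv_card_ge0. Qed.

Let bij_mean_merge (chi : dualn) : supp chi = A ->
  bij_mean chi = - (x * \sum_(i in D) y chi i).
Proof.
move=> sA; have := @bij_mean_rec _ abG chi j; rewrite sA => /(_ jA).
rewrite -/D => e; rewrite -mulrN -e mulKf // pnatr_eq0 -lt0n subn_gt0.
exact: D_lt.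
Qed.

(** Cube [bij_mean_merge], keep only the cancelling cubes by [sum_cube_error], and evaluate those by
    [sum_cancelling_pair]. The plus sign comes from the cube of -x. *)
Let supp_sum_merge :
  `|supp_sum f A + x ^+ 3 *
     \sum_(i in D) ((n * (f i == f j))%:R - 1) * supp_sum f (D :\ i)|
  <= (h.*2.+2 ^ 3 * cube_const h.*2)%:R * q ^+ h.*2.+3.
Proof.
have -> : \sum_(i in D) ((n * (f i == f j))%:R - 1) * supp_sum f (D :\ i) =
    \sum_(chi : dualn | supp chi == A) (\sum_(i in E chi) y chi i ^+ 3) * chiev chi f.
  under eq_bigr => i iD do rewrite -(sum_cancelling_pair abG f jA iD).
  rewrite (exchange_big_dep (fun chi : dualn => supp chi == A)) /=; last first.
    by move=> i chi _ /andP[].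
  apply: eq_bigr => chi sA; rewrite mulr_suml; apply: eq_bigl => i.
  by rewrite [RHS]inE sA.
have -> : supp_sum f A = \sum_(chi : dualn | supp chi == A)
    - x ^+ 3 * ((\sum_(i in D) y chi i) ^+ 3 * chiev chi f).
  apply: eq_bigr => chi /eqP sA; rewrite bij_mean_merge //.
  by rewrite mulrA; congr (_ * _); rewrite exprNn exprMn -signr_odd expr1 mulN1r mulNr.
rewrite mulr_sumr -big_split /=.
apply: (@le_trans _ _ (\sum_(chi : dualn | supp chi == A) x ^+ 3 *
     `|(\sum_(i in D) y chi i) ^+ 3 - \sum_(i in E chi) y chi i ^+ 3|)).
  apply: (le_trans (ler_norm_sum _ _ _)); apply: ler_sum => chi _.
  rewrite mulNr addrC -mulrBr -mulrBl normrM [`|_ * chiev _ _|]normrM norm_chiev // mulr1 distrC.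
  by rewrite (ger0_norm (exprn_ge0 3 x_ge0)).
rewrite -mulr_sumr -[h.*2.+3]addn3 addnC exprD natrM mulrACA.
by apply: ler_pM; rewrite ?exprn_ge0 ?sumr_ge0.
Qed.

(** The first summand is the error of [supp_sum_merge]; the second replaces the coefficient of each
    of the [m.+1] terms. *)
Definition pairing_const (m : nat) : nat :=
  m.+2 ^ 3 * cube_const m
  + m.+1 * ((3 * m.+1 + 1) * m.+3 ^ 3 * (sup_const m * energy_const m)).

(** The coefficient x^3 (n [f(i) = f(j)] - 1) becomes q^2 [f(i) = f(j)]: both n x^3 - q^2 and the
    stray x^3 are O(q^3). *)
Lemma supp_sum_pairing :
  `|supp_sum f A
    + q ^+ 2 * \sum_(i in A :\ j) (f i == f j)%:R * supp_sum f (A :\ j :\ i)|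
  <= (pairing_const h.*2)%:R * q ^+ h.*2.+3.
Proof.
have q0 := inv_card_ge0 gT; rewrite -/D.
set S := supp_sum f A.
set T1 := x ^+ 3 * \sum_(i in D) ((n * (f i == f j))%:R - 1) * supp_sum f (D :\ i).
set T2 := q ^+ 2 * _.
have -> : S + T2 = (S + T1) - (T1 - T2) by rewrite opprB addrACA subrr addr0.
apply: (le_trans (ler_normB _ _)); rewrite natrD mulrDl; apply: lerD.
  exact: supp_sum_merge.
have -> : T1 - T2 = \sum_(i in D)
    ((f i == f j)%:R * (n%:R * x ^+ 3 - q ^+ 2) - x ^+ 3) * supp_sum f (D :\ i).
  rewrite /T1 /T2 !mulr_sumr -sumrB; apply: eq_bigr => i _.
  have rearrange (R : comPzRingType) (a b c d e : R) :
    a * ((b * c - 1) * d) - e * (c * d) = (c * (b * a - e) - a) * d by ring.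
  by rewrite natrM rearrange.
(* [inv_cube_approx] with s = |D| and M = [h.*2.+2] gives the 3s; the 1 is for x^3, whose constant
   [h.*2.+2 ^ 3] is rounded up. *)
set c := ((3 * h.*2.+1 + 1) * h.*2.+3 ^ 3)%N.
have coef_le i : `|(f i == f j)%:R * (n%:R * x ^+ 3 - q ^+ 2) - x ^+ 3| <= c%:R * q ^+ 3.
  apply: (le_trans (ler_normB _ _)); rewrite /c mulnDl mul1n natrD mulrDl; apply: lerD.
    rewrite normrM normr_nat.
    apply: (@le_trans _ _ `|n%:R * x ^+ 3 - q ^+ 2|).
      by case: (f i == f j); rewrite ?mul1r ?mul0r.
    apply: inv_cube_approx; rewrite ?subn_gt0 //.
    by rewrite -cardD subnK // ltnW.
  rewrite ger0_norm ?exprn_ge0 //; apply: (le_trans x_cube_le).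
  by rewrite ler_wpM2r ?exprn_ge0 // ler_nat leq_exp2r.
apply: (le_trans (ler_norm_sum _ _ _)).
apply: (@le_trans _ _ (\sum_(i in D) (c * (sup_const h.*2 * energy_const h.*2))%:R * q ^+ h.*2.+3)).
  apply: ler_sum => i iD; rewrite normrM -[h.*2.+3]addn3 addnC exprD natrM mulrACA.
  apply: ler_pM => //; have := norm_supp_sum_le abG f (D :\ i).
  by rewrite cardDi // uphalf_double.
by rewrite sumr_const cardD -[_ *+ _]mulr_natl mulrA -natrM.
Qed.

End PairingRecursion.

(** * Counting sets of given size and double counting removed pairs *)

Lemma ffact_leq_exp n m : (n ^_ m <= n ^ m)%N.
Proof.
by elim: m => // m IH; rewrite ffactnSr expnSr leq_mul // leq_subr.
Qed.

Lemma bin_leq_exp n m : ('C(n, m) <= n ^ m)%N.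
Proof.
by apply: leq_trans (ffact_leq_exp n m); rewrite -bin_ffact leq_pmulr ?fact_gt0.
Qed.

Lemma sum_card_le (R : numDomainType) (I : finType) (m : nat) (F : {set I} -> R) (w : R) :
  0 <= w -> (forall A : {set I}, #|A| = m -> F A <= w) ->
  \sum_(A : {set I} | #|A| == m) F A <= (#|I| ^ m)%:R * w.
Proof.
move=> w0 Fw; apply: (@le_trans _ _ (\sum_(A : {set I} | #|A| == m) w)).
  by apply: ler_sum => A /eqP /Fw.
rewrite sumr_const -[w *+ _]mulr_natl ler_wpM2r // ler_nat.
apply: leq_trans (bin_leq_exp #|I| m); rewrite -card_draws.
by apply/eq_leq/eq_card => A; rewrite inE.
Qed.

Section RemovePair.
Variables (R : numDomainType) (I : finType) (e : rel I) (W : {set I} -> R) (m : nat).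

(** For fixed distinct i and j, removing both is a bijection from the sets containing them onto the
    smaller sets avoiding them. *)
Lemma sum_remove_pair :
  \sum_(A : {set I} | #|A| == m.+2) \sum_(j in A) \sum_(i in A :\ j)
     (e i j)%:R * W (A :\ j :\ i) =
  \sum_j \sum_(i | i != j) (e i j)%:R *
    \sum_(B : {set I} | (#|B| == m) && ((i \notin B) && (j \notin B))) W B.
Proof.
rewrite (exchange_big_dep predT) //=; apply: eq_bigr => j _.
rewrite (exchange_big_dep (fun i => i != j)) /=; last first.
  by move=> A i _ /setD1P[].
apply: eq_bigr => i ij; rewrite mulr_sumr.
rewrite (reindex_onto (fun B : {set I} => j |: (i |: B)) (fun A => A :\ j :\ i)) /=; last first.
  by move=> A /andP[/andP[_ jA] iA]; rewrite !setD1K.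
apply: eq_big => [B|B].
  have [jB|jB] := boolP (j \in B).
    rewrite !andbF; apply/negP=> /andP[_ /eqP/setP/(_ j)].
    by rewrite !inE eqxx jB andbF.
  have [iB|iB] := boolP (i \in B).
    rewrite !andbF; apply/negP=> /andP[_ /eqP/setP/(_ i)].
    by rewrite !inE eqxx iB.
  have jiB : j \notin i |: B by rewrite !inE negb_or eq_sym ij.
  by rewrite (setU1K jiB) (setU1K iB) eqxx !cardsU1 jiB iB !inE !eqxx /= !andbT !add1n.
case/andP=> /andP[/andP[_ _] _] /eqP ->.
by [].
Qed.

(** The error comes from the sets [B] meeting {i, j}. Summed over i, each [B] containing i is
    counted m times, and j is free; the case of j is symmetric, hence the 2. *)
Lemma sum_remove_pair_approx (w : R) : 0 <= w -> (forall B : {set I}, #|B| = m -> `|W B| <= w) ->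
  `|\sum_(A : {set I} | #|A| == m.+2) \sum_(j in A) \sum_(i in A :\ j)
      (e i j)%:R * W (A :\ j :\ i)
    - (\sum_j \sum_(i | i != j) (e i j)%:R) * \sum_(B : {set I} | #|B| == m) W B|
  <= (2 * m * #|I| * #|I| ^ m)%:R * w.
Proof.
move=> w0 Ww; rewrite sum_remove_pair distrC mulr_suml -sumrB.
have mem_sum (B : {set I}) : \sum_(i in B) `|W B| = #|B|%:R * `|W B|.
  by rewrite sumr_const mulr_natl.
have half_le : \sum_(j : I) \sum_(i : I) \sum_(B : {set I} | (#|B| == m) && (i \in B)) `|W B|
    <= (#|I| * m * #|I| ^ m)%:R * w.
  rewrite sumr_const -[_ *+ #|_|]mulr_natl -mulnA natrM -mulrA ler_wpM2l ?ler0n //.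
  rewrite (exchange_big_dep (fun B : {set I} => #|B| == m)) /=; last by move=> i B _ /andP[].
  rewrite mulnC natrM -mulrA; apply: sum_card_le => [|B Bm].
    by rewrite mulr_ge0 ?ler0n.
  have -> : \sum_(i | (#|B| == m) && (i \in B)) `|W B| = \sum_(i in B) `|W B|.
    by apply: eq_bigl => i; rewrite Bm eqxx.
  by rewrite mem_sum Bm ler_wpM2l ?ler0n ?Ww.
apply: (@le_trans _ _ (\sum_(j : I) \sum_(i : I)
  (\sum_(B : {set I} | (#|B| == m) && (i \in B)) `|W B|
   + \sum_(B : {set I} | (#|B| == m) && (j \in B)) `|W B|))).
  apply: (le_trans (ler_norm_sum _ _ _)); apply: ler_sum => j _.
  rewrite mulr_suml -sumrB; apply: (le_trans (ler_norm_sum _ _ _)).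
  rewrite [leRHS](bigID (fun i => i != j)) /= ler_wpDr //.
    by rewrite sumr_ge0 // => i _; rewrite addr_ge0 ?sumr_ge0.
  apply: ler_sum => i ij; rewrite -mulrBr normrM normr_nat.
  set X := `|_|; apply: (@le_trans _ _ X); first by case: (e i j); rewrite ?mul1r ?mul0r ?normr_ge0.
  rewrite {}/X [X in `|X - _|](bigID (fun B : {set I} =>
    (i \notin B) && (j \notin B))) /= addrC addrK.
  apply: (le_trans (ler_norm_sum _ _ _)).
  rewrite [leLHS](bigID (fun B : {set I} => i \in B)) /=; apply: lerD.
    rewrite le_eqVlt; apply/orP; left; apply/eqP/eq_bigl => B.
    by case: (i \in B); rewrite ?andbF ?andbT.
  rewrite big_mkcond [leRHS]big_mkcond; apply: ler_sum => B _.
  by case: (#|B| == m); case: (i \in B); case: (j \in B); rewrite /= ?lexx ?normr_ge0.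
have -> : (2 * m * #|I| * #|I| ^ m)%:R * w =
    (#|I| * m * #|I| ^ m)%:R * w + (#|I| * m * #|I| ^ m)%:R * w.
  by rewrite -mulrDl -natrD addnn -mul2n !mulnA -(mulnA 2 #|I|) [(#|I| * m)%N]mulnC mulnA.
under eq_bigr => j _ do rewrite big_split /=.
by rewrite big_split /= lerD // exchange_big.
Qed.

End RemovePair.

(** * Sums over all m-sparse characters *)

Section SparseSums.
Variable gT : finGroupType.
Hypothesis abG : abelian [set: gT].
Local Notation dual := (Iirr [set: gT]).
Local Notation n := #|gT|.
Local Notation dualn := {ffun 'I_n -> dual}.
Local Notation q := (n%:R^-1 : algC).
Variable f : 'I_n -> gT.

Definition sparse_sum (m : nat) : algC :=
  \sum_(A : {set 'I_n} | #|A| == m) supp_sum f A.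

Definition fibre_sqr : algC := \sum_(x : gT) ((fibre_card f x) ^ 2)%:R.

(** Both sides count ordered pairs of indices with equal values of [f]. *)
Lemma fibre_sqrE : fibre_sqr = \sum_j \sum_i (f i == f j)%:R.
Proof.
rewrite (partition_big f predT) //=; apply: eq_bigr => x _.
rewrite [RHS](eq_bigr (fun=> (fibre_card f x)%:R)) => [|j /eqP <-].
  rewrite sumr_const -[RHS]mulr_natl -natrM; congr _%:R.
  by rewrite expnS expn1; congr (_ * _)%N; apply: eq_card => i; rewrite !inE.
rewrite -natr_sum; congr _%:R; rewrite /fibre_card -sum1_card [RHS]big_mkcond.
by apply: eq_bigr => i _; rewrite inE; case: eqP.
Qed.

Lemma fibre_sqr_ge0 : 0 <= fibre_sqr.
Proof. by apply: sumr_ge0 => x _; rewrite ler0n. Qed.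

Lemma fibre_sqr_le : fibre_sqr <= n%:R ^+ 2.
Proof.
rewrite fibre_sqrE; have -> : n%:R ^+ 2 = \sum_(j < n) \sum_(i < n) 1 :> algC.
  by rewrite !sumr_const !card_ord -mulrnA -natrX.
by apply: ler_sum => j _; apply: ler_sum => i _; case: (f i == f j); rewrite ?ler01.
Qed.

Lemma fibre_sqr_off_diag :
  \sum_j \sum_(i | i != j) (f i == f j)%:R = fibre_sqr - n%:R :> algC.
Proof.
rewrite fibre_sqrE; have -> : n%:R = \sum_(j < n) 1 :> algC.
  by rewrite sumr_const card_ord.
rewrite -sumrB; apply: eq_bigr => j _.
by rewrite [in RHS](bigD1 j) //= eqxx addrAC subrr add0r.
Qed.

Definition supp_const (m : nat) : nat := sup_const m * energy_const m.

Lemma norm_supp_sum_even h (A : {set 'I_n}) : #|A| = h.*2 ->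
  `|supp_sum f A| <= (supp_const h.*2)%:R * q ^+ h.*2.
Proof.
by move=> Ah; have := norm_supp_sum_le abG f A; rewrite Ah uphalf_double.
Qed.

Lemma expn_inv_card k : (n ^ k)%:R * q ^+ k = 1.
Proof. by rewrite natrX -exprMn mulrC mul_inv_card expr1n. Qed.

Lemma norm_sparse_sum_even h : `|sparse_sum h.*2| <= (supp_const h.*2)%:R.
Proof.
apply: (le_trans (ler_norm_sum _ _ _)).
apply: (le_trans (sum_card_le (w := (supp_const h.*2)%:R * q ^+ h.*2) _ _)).
- by rewrite mulr_ge0 ?ler0n ?exprn_ge0 ?inv_card_ge0.
- by move=> A /norm_supp_sum_even.
by rewrite card_ord mulrCA expn_inv_card mulr1.
Qed.

(** In order: the pairing error for each of the [m.+2] choices of j, the sets meeting the removed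
    pair, and the diagonal i = j missing from [fibre_sqr]. *)
Definition step_const (m : nat) : nat :=
  m.+2 * pairing_const m + (2 * m * supp_const m + supp_const m).

(** The factor [h.*2.+2] counts the choices of j in a support, so [supp_sum_pairing] is summed over
    all pairs (A, j). Each of the three errors is O(q): n^(m+2) supports against q^(m+3), then q^2
    n^(m+1) q^m, then q^2 n. *)
Lemma sparse_sum_rec h :
  `|h.*2.+2%:R * sparse_sum h.*2.+2 + q ^+ 2 * fibre_sqr * sparse_sum h.*2|
    <= (step_const h.*2)%:R * q.
Proof.
have q0 := inv_card_ge0 gT; set m := h.*2; set c := supp_const m.
pose T : algC := \sum_(A : {set 'I_n} | #|A| == m.+2) \sum_(j in A) \sum_(i in A :\ j)
     (f i == f j)%:R * supp_sum f (A :\ j :\ i).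
have Vm : m.+2%:R * sparse_sum m.+2 =
    \sum_(A : {set 'I_n} | #|A| == m.+2) \sum_(j in A) supp_sum f A.
  by rewrite mulr_sumr; apply: eq_bigr => A /eqP Am; rewrite sumr_const Am mulr_natl.
have step1 : `|m.+2%:R * sparse_sum m.+2 + q ^+ 2 * T| <= (m.+2 * pairing_const m)%:R * q.
  have -> : (m.+2 * pairing_const m)%:R * q = (#|'I_n| ^ m.+2)%:R *
      ((m.+2 * pairing_const m)%:R * q ^+ m.+3).
    by rewrite card_ord mulrCA [q ^+ _]exprSr [_ * (_ * q)]mulrA expn_inv_card mul1r.
  rewrite Vm /T mulr_sumr -big_split /=; apply: (le_trans (ler_norm_sum _ _ _)).
  apply: sum_card_le => [|A Am]; first by rewrite mulr_ge0 ?ler0n ?exprn_ge0.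
  rewrite mulr_sumr -big_split /=; apply: (le_trans (ler_norm_sum _ _ _)).
  have -> : (m.+2 * pairing_const m)%:R * q ^+ m.+3 =
      \sum_(j in A) (pairing_const m)%:R * q ^+ m.+3.
    by rewrite sumr_const Am natrM -mulrA mulr_natl.
  by apply: ler_sum => j jA; apply: supp_sum_pairing.
have w0 : 0 <= c%:R * q ^+ m by rewrite mulr_ge0 ?ler0n ?exprn_ge0.
have step2 : `|q ^+ 2 * (T - (fibre_sqr - n%:R) * sparse_sum m)| <= (2 * m * c)%:R * q.
  rewrite normrM (ger0_norm (exprn_ge0 2 q0)).
  have := @sum_remove_pair_approx _ _ (fun i j => f i == f j) (supp_sum f) m _ w0
    (fun A Am => norm_supp_sum_even Am).
  rewrite fibre_sqr_off_diag -/T card_ord => H.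
  apply: (le_trans (ler_wpM2l (exprn_ge0 2 q0) H)).
  have regroup (R : comPzRingType) (a b z r s t : R) : r * z = 1 -> t * s = 1 ->
      r ^+ 2 * (a * z * t * (b * s)) = a * b * r.
    move=> rz ts; have -> : r ^+ 2 * (a * z * t * (b * s)) =
      (r * z) * (t * s) * (a * b * r) by ring.
    by rewrite rz ts !mul1r.
  by rewrite (natrM _ _ (n ^ m)) (natrM _ _ n) regroup ?expn_inv_card ?mul_inv_card // -natrM.
have step3 : `|q ^+ 2 * (n%:R * sparse_sum m)| <= c%:R * q.
  rewrite mulrA [q ^+ 2]expr2 -[q * q * _]mulrA mul_inv_card mulr1 normrM (ger0_norm q0) mulrC.
  by rewrite ler_wpM2r // norm_sparse_sum_even.
have -> : m.+2%:R * sparse_sum m.+2 + q ^+ 2 * fibre_sqr * sparse_sum m =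
   (m.+2%:R * sparse_sum m.+2 + q ^+ 2 * T) -
   (q ^+ 2 * (T - (fibre_sqr - n%:R) * sparse_sum m) - q ^+ 2 * (n%:R * sparse_sum m)).
  have regroup (R : comPzRingType) (a b t s z v : R) :
    a + b * s * v = a + b * t - (b * (t - (s - z) * v) - b * (z * v)) by ring.
  exact: regroup.
rewrite /step_const [X in _ <= X * _]natrD [leRHS]mulrDl.
apply: (le_trans (ler_normB _ _)); apply: lerD => //.
rewrite [X in _ <= X * _]natrD [leRHS]mulrDl.
by apply: (le_trans (ler_normB _ _)); apply: lerD.
Qed.

(** The formula is exact at sparsity 0, and later steps only add errors without amplifying old
    ones. *)
Fixpoint even_const (h : nat) : nat :=
  if h is k.+1 then step_const k.*2 + even_const k else 0.

Lemma sparse_sum_even h :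
  `|sparse_sum h.*2 - (h`!)%:R^-1 *
      (- ((2 * n ^ 2)%:R^-1 * fibre_sqr)) ^+ h| <= (even_const h)%:R * q.
Proof.
have q0 := inv_card_ge0 gT; set P := - (_ * fibre_sqr).
have n2 : (2 * n ^ 2)%:R^-1 = 2%:R^-1 * q ^+ 2 :> algC.
  by rewrite natrM natrX invfM exprVn.
(* This keeps the error inherited from the induction hypothesis from growing. *)
have P1 : `|P| <= 1.
  have F0 := fibre_sqr_ge0.
  have qF0 : 0 <= q ^+ 2 * fibre_sqr by rewrite mulr_ge0 ?exprn_ge0.
  have qF1 : q ^+ 2 * fibre_sqr <= 1.
    apply: (le_trans (ler_wpM2l (exprn_ge0 2 q0) fibre_sqr_le)).
    by rewrite -exprMn mul_inv_card expr1n.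
  have half0 : 0 <= 2%:R^-1 :> algC by rewrite invr_ge0 ler0n.
  have half1 : 2%:R^-1 <= 1 :> algC by rewrite invf_le1 ?ltr0n // ler1n.
  by rewrite normrN n2 -mulrA ger0_norm ?mulr_ge0 // mulr_ile1.
elim: h => [|h IH].
  rewrite mul0r expr0 mulr1 invr1 /sparse_sum (big_pred1 set0) => [|A]; last by rewrite cards_eq0.
  rewrite /supp_sum (big_pred1 [ffun=> 0]) => [|chi]; last exact: supp_eq0.
  rewrite bij_mean0 => [|]; last by apply/eqP; rewrite supp_eq0.
  rewrite expr1n mul1r /chiev big1 => [|i _]; last by rewrite ffunE irr0 cfun1E inE.
  by rewrite subrr normr0.
have h0 : h.*2.+2%:R != 0 :> algC by rewrite pnatr_eq0.
(* Dividing by 2h + 2 supplies both the next factor of the factorial and the 1/2 inside [P]. *)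
have h2 : h.+1%:R^-1 * 2%:R^-1 = h.*2.+2%:R^-1 :> algC.
  by rewrite -invfM -natrM muln2.
rewrite doubleS; set X := sparse_sum h.*2.+2; set Y := sparse_sum h.*2 in IH *.
have -> : X - ((h.+1)`!)%:R^-1 * P ^+ h.+1 =
    h.*2.+2%:R^-1 * (h.*2.+2%:R * X + q ^+ 2 * fibre_sqr * Y)
    + h.+1%:R^-1 * (P * (Y - (h`!)%:R^-1 * P ^+ h)).
  have -> : h.*2.+2%:R^-1 * (h.*2.+2%:R * X + q ^+ 2 * fibre_sqr * Y) =
     X - h.+1%:R^-1 * (P * Y).
    rewrite mulrDr mulKf // -h2 /P n2.
    have regroup (R : comPzRingType) (a b c d x y : R) :
      x + a * b * (c * d * y) = x - a * (- (b * c * d) * y) by ring.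
    exact: regroup.
  rewrite factS natrM invfM exprS.
  have regroup (R : comPzRingType) (a b c p x y : R) :
    x - a * b * (p * c) = x - a * (p * y) + a * (p * (y - b * c)) by ring.
  exact: regroup.
rewrite [X in _ <= X * _](natrD _ (step_const h.*2)) [leRHS]mulrDl.
apply: (le_trans (ler_normD _ _)).
have inv_le1 k : `|k.+1%:R^-1 : algC| <= 1.
  by rewrite normfV normr_nat invf_le1 ?ltr0n // ler1n.
apply: lerD; rewrite normrM.
  by apply: le_trans (sparse_sum_rec h); rewrite ler_piMl.
rewrite normrM; apply: le_trans IH; rewrite mulrA ler_piMl //.
by apply: mulr_ile1.
Qed.

Lemma sum_sparse (m : nat) (F : dualn -> algC) :
  \sum_(chi : dualn | sparse m chi) F chi =
  \sum_(A : {set 'I_n} | #|A| == m) \sum_(chi : dualn | supp chi == A) F chi.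
Proof.
rewrite (partition_big (@supp gT) (fun A => #|A| == m)) //=.
apply: eq_bigr => A Am; apply: eq_bigl => chi.
by rewrite /sparse -/(supp chi) andbC; case: eqP => //= ->.
Qed.

Lemma sum_sparse_hat1S m :
  \sum_(chi : dualn | sparse m chi) hat1S chi ^+ 3 * chiev chi f =
  sparse_sum m * ((n`!)%:R / (n ^ n)%:R) ^+ 3.
Proof.
rewrite sum_sparse mulr_suml; apply: eq_bigr => A _; rewrite mulr_suml.
by apply: eq_bigr => chi _; rewrite hat1SE exprMn mulrAC.
Qed.

(** For odd m the exponent [(uphalf m).*2] equals m + 1, so one factor [q] survives the sum over at
    most n^m supports. *)
Lemma sum_sparse_odd m : odd m ->
  \sum_(chi : dualn | sparse m chi) `|hat1S chi| ^+ 3 <=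
    (supp_const m)%:R * (q * ((n`!)%:R / (n ^ n)%:R) ^+ 3).
Proof.
move=> modd; have q0 := inv_card_ge0 gT; set kappa := _ / _.
have k0 : 0 <= kappa by rewrite divr_ge0 ?ler0n.
rewrite mulrA sum_sparse.
under eq_bigr => A _ do under eq_bigr => chi _ do
  rewrite hat1SE normrM (ger0_norm k0) exprMn.
under eq_bigr => A _ do rewrite -mulr_suml.
rewrite -mulr_suml ler_wpM2r ?exprn_ge0 //.
have -> : (supp_const m)%:R * q = (#|'I_n| ^ m)%:R * ((supp_const m)%:R * q ^+ m.+1).
  by rewrite card_ord mulrCA [q ^+ _]exprSr [_ * (_ * q)]mulrA expn_inv_card mul1r.
apply: sum_card_le => [|A Am]; first by rewrite mulr_ge0 ?ler0n ?exprn_ge0.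
have := sum_cube_le abG A; rewrite Am.
by rewrite uphalf_half modd add1n doubleS -[in m.+1](odd_double_half m) modd add1n.
Qed.

End SparseSums.

Theorem theorem3p1 :
  forall m : nat, exists C : algC,
  forall (gT : finGroupType), abelian [set: gT] ->
  forall f : 'I_#|gT| -> gT,
    let n := #|gT| in
    let err := C * (n%:R^-1 * ((n`!)%:R / (n ^ n)%:R) ^+ 3) in
    (~~ odd m ->
      `| \sum_(chi : {ffun 'I_n -> Iirr [set: gT]} | sparse m chi)
            hat1S chi ^+ 3 * chiev chi f
         - ((m./2)`!)%:R^-1
           * (- ((2 * n ^ 2)%:R^-1 * (\sum_(x : gT) ((fibre_card f x) ^ 2)%:R))) ^+ m./2
           * ((n`!)%:R / (n ^ n)%:R) ^+ 3 | <= err)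
    /\
    (odd m ->
      \sum_(chi : {ffun 'I_n -> Iirr [set: gT]} | sparse m chi) `| hat1S chi | ^+ 3 <= err).
Proof.
move=> m; exists (if odd m then supp_const m else even_const m./2)%:R => gT abG f n err.
split=> [modd | modd]; rewrite /err.
  rewrite (negPf modd) sum_sparse_hat1S -mulrBl normrM.
  have k0 : 0 <= (n`!)%:R / (n ^ n)%:R :> algC by rewrite divr_ge0 ?ler0n.
  rewrite (ger0_norm (exprn_ge0 3 k0)) [leRHS]mulrA ler_wpM2r ?exprn_ge0 //.
  have := sparse_sum_even abG f m./2.
  by rewrite even_halfK.
by rewrite modd; apply: sum_sparse_odd.
Qed.
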